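(* Let $Q_n$ denote the $n$-dimensional hypercube. Then $\mathrm{capt}(Q_n) = \Theta(n \ln n)$ as $n \to \infty$; that is, there are absolute constants $c_1, c_2 > 0$ and $n_0$ such that $c_1 n \ln n \le \mathrm{capt}(Q_n) \le c_2 n \ln n$ for all $n \ge n_0$.
   Context: Cops and Robbers is played on a finite reflexive graph (every vertex carries a loop, so a player may pass). A set of cops first chooses starting vertices (turn 0), then the robber chooses a starting vertex; afterwards players alternate, the cops moving first: on the cops' turn each cop moves to a neighbouring vertex or stays, and on the robber's turn the robber moves to a neighbouring vertex or stays. A round is a cop move together with the subsequent robber move. The cops win (capture the robber) when some cop occupies the same vertex as the robber. The cop number $c(G)$ is the minimum number of cops having a winning strategy. For $k \ge c(G)$, the $k$-capture time $\mathrm{capt}_k(G)$ is the minimum, over strategies of $k$ cops, of the number of rounds (not counting the initial round 0) needed to capture the robber, assuming the robber plays to delay capture as long as possible; $\mathrm{capt}(G) = \mathrm{capt}_{c(G)}(G)$. The hypercube $Q_n$ is the $n$-fold Cartesian product of $K_2$ (vertices are binary strings of length $n$, adjacent when they differ in exactly one coordinate); $c(Q_n) = \lceil (n+1)/2 \rceil$. *)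

(* Defs.v *)
From mathcomp Require Import all_boot all_order all_algebra.
From mathcomp Require Import all_classical all_reals all_analysis.

Set Implicit Arguments.
Unset Strict Implicit.
Unset Printing Implicit Defensive.

(* A graph is a finite vertex type [T] with an adjacency relation [e]. *)
(* One move of a player: every vertex is treated as carrying a loop. *)
Definition step (T : finType) (e : rel T) : rel T :=
  [rel x y | (x == y) || e x y].

(* [r i] is the robber's vertex after round [i]; [r 0] is his starting vertex.
   Against a fixed cop strategy, the robber's ways of playing are exactly the
   walks. *)
Definition robber_walk (T : finType) (e : rel T) (r : nat -> T) : Prop :=
  forall i, step e (r i) (r i.+1).

(* A strategy for [k] cops maps the robber's past vertices
   [:: r 0; ...; r i.-1] to the position of the cops after their move of
   round [i]; its value at [::] is the position chosen in round 0, before the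
   robber appears. *)
Definition cop_strategy (T : finType) (k : nat) : Type :=
  seq T -> {ffun 'I_k -> T}.

Definition cops_at (T : finType) (k : nat) (s : cop_strategy T k)
  (r : nat -> T) (i : nat) : {ffun 'I_k -> T} := s (mkseq r i).

Definition legal (T : finType) (e : rel T) (k : nat) (s : cop_strategy T k) :
    Prop :=
  forall r, robber_walk e r ->
  forall i (j : 'I_k), step e (cops_at s r i j) (cops_at s r i.+1 j).

(* In round [i > 0] the cops move while the robber is on [r i.-1], after which
   the robber moves to [r i]; a capture can occur at either move.  In round 0
   both disjuncts say that the robber starts on a cop, since [0.-1 = 0]. *)
Definition captured_in (T : finType) (k : nat) (s : cop_strategy T k)
    (r : nat -> T) (i : nat) : Prop :=
  exists j : 'I_k, cops_at s r i j = r i.-1 \/ cops_at s r i j = r i.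

Definition winning (T : finType) (e : rel T) (k : nat) (s : cop_strategy T k) :
    Prop :=
  legal e s /\ forall r, robber_walk e r -> exists i, captured_in s r i.

Definition winning_within (T : finType) (e : rel T) (k t : nat)
    (s : cop_strategy T k) : Prop :=
  legal e s /\
  forall r, robber_walk e r -> exists2 i, (i <= t)%N & captured_in s r i.

Definition cops_win (T : finType) (e : rel T) (k : nat) : Prop :=
  exists s : cop_strategy T k, winning e s.

Definition cops_win_within (T : finType) (e : rel T) (k t : nat) : Prop :=
  exists s : cop_strategy T k, winning_within e t s.

Lemma cops_win_card (T : finType) (e : rel T) : cops_win e #|T|.
Proof.
exists (fun=> [ffun j => enum_val j]); split.
  by move=> r _ i j; rewrite /cops_at /step /= eqxx.
move=> r _; exists 0%N, (enum_rank (r 0%N)); right.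
by rewrite /cops_at ffunE enum_rankK.
Qed.

Lemma cop_number_subproof (T : finType) (e : rel T) :
  exists k, `[< cops_win e k >].
Proof. by exists #|T|; apply/asboolP/cops_win_card. Qed.

Definition cop_number (T : finType) (e : rel T) : nat :=
  ex_minn (cop_number_subproof e).

Lemma cop_number_win (T : finType) (e : rel T) : cops_win e (cop_number e).
Proof. by rewrite /cop_number; case: ex_minnP => k /asboolP. Qed.

Lemma captured_in_prefix (T : finType) (k : nat) (s : cop_strategy T k)
    (r r' : nat -> T) (i : nat) :
  (forall m, (m <= i)%N -> r m = r' m) -> captured_in s r i ->
  captured_in s r' i.
Proof.
move=> rr' [j Hj]; exists j.
have -> : cops_at s r' i = cops_at s r i.
  rewrite /cops_at /mkseq; congr s; apply/eq_in_map => m.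
  by rewrite mem_iota => /andP[_ /ltnW mi]; rewrite rr'.
by rewrite -!rr' // leq_pred.
Qed.

(* König's lemma: on a finite graph a winning strategy has a uniform bound on
   the number of rounds it needs. *)
Lemma winning_bounded (T : finType) (e : rel T) (k : nat)
    (s : cop_strategy T k) :
  winning e s -> exists t, winning_within e t s.
Proof.
move=> [sl sw]; apply: contrapT => nobound.
pose good (p : seq T) := forall t, exists r, [/\ robber_walk e r,
  mkseq r (size p) = p & forall i, (i <= t)%N -> ~ captured_in s r i].
have good0 : good [::].
  move=> t; apply: contrapT => H; apply: nobound; exists t; split=> // r rw.
  apply: contrapT => nc; apply: H; exists r; split=> // i it ci.
  by apply: nc; exists i.
have [x0 _] : exists x : T, True by have [r _] := good0 0%N; exists (r 0%N).
have goodS p : exists v, good p -> good (rcons p v).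
  have [gp|ngp] := pselect (good p); last by exists x0.
  apply: contrapT => nv.
  have /choice[f Hf] : forall v, exists t, ~ exists r, [/\ robber_walk e r,
      mkseq r (size (rcons p v)) = rcons p v
      & forall i, (i <= t)%N -> ~ captured_in s r i].
    by move=> v; apply/existsNP => gv; apply: nv; exists v.
  have [r [rw rp rc]] := gp (\max_v f v).
  apply: (Hf (r (size p))); exists r; split=> //.
    by rewrite size_rcons mkseqS rp.
  by move=> i iv; apply: rc; apply: leq_trans iv _; apply: leq_bigmax.
have [g Hg] := choice goodS.
pose S n := iter n (fun p => rcons p (g p)) [::].
pose r n := g (S n).
have Sr n : S n = mkseq r n.
  by elim: n => // n IHn; rewrite mkseqS -IHn.
have gS n : good (mkseq r n).
  by rewrite -Sr; elim: n => // n IHn; apply: Hg.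
have agree n : exists r', [/\ robber_walk e r',
    forall m, (m < n)%N -> r' m = r m
    & forall i, (i <= n)%N -> ~ captured_in s r' i].
  have [r' [rw' Er' nc]] := gS n n; exists r'; split=> // m mn.
  move: Er'; rewrite size_mkseq => /(congr1 (fun p => nth x0 p m)).
  by rewrite !nth_mkseq.
have rw : robber_walk e r.
  by move=> i; have [r' [rw' E _]] := agree i.+2; rewrite -!E.
have [i ci] := sw r rw.
have [r' [_ E nc]] := agree i.+1; apply: (nc i) => //.
by apply: captured_in_prefix ci => m mi; rewrite E.
Qed.

Lemma capture_time_subproof (T : finType) (e : rel T) (k : nat) :
  cops_win e k -> exists t, `[< cops_win_within e k t >].
Proof.
move=> [s /winning_bounded[t st]].
by exists t; apply/asboolP; exists s.
Qed.

(* The [k]-capture time, defined only when [k] cops can win (k >= cop_number e). *)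
Definition capture_time_with (T : finType) (e : rel T) (k : nat)
    (kwin : cops_win e k) : nat :=
  ex_minn (capture_time_subproof kwin).

Definition capture_time (T : finType) (e : rel T) : nat :=
  capture_time_with (cop_number_win e).

Definition hypercube (n : nat) : rel (n.-tuple bool) :=
  [rel x y | #|[set i : 'I_n | tnth x i != tnth y i]| == 1%N].

Arguments hypercube n : clear implicits.

(* Main.v *)
(* Describe a position by the sets [D j] of coordinates in which cop [j] and the
   robber differ.

   Upper bound.  The cops keep all [#|D j|] even.  Let [c x] be the number of
   cops [j] with [x] in [D j]; if [sum_j #|D j| >= (n+1) tau] then [tau] distinct
   cops can each sacrifice a coordinate with [c x > tau].  When the robber flips
   [i], these cops trade their coordinate for [i], while any other cop hit by the
   move drops [i] and a second coordinate.  Afterwards [c i <= tau] and no other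
   [c x] has grown, so [sum_x max(tau, c x)] has dropped by [tau].  Passing does
   not help the robber: the cops play their sacrifices at once and answer
   later.  Hence O(n) rounds halve [sum_j #|D j|] or capture, and this sum is at
   least [2k >= n+1] as long as the robber is free.

   Lower bounds.  With [2k <= n] cops the robber can always stay at distance at
   least 2 from all of them.  Against at most [n] cops he plays so as not to
   increase [sum_j (1 - y)^#|D j|], which a random flip achieves on average when
   [1/2 >= y] grows by a factor [1/(1 - 3/n)] each round; starting from [y] of
   order [n^(-1/2)], about [n ln n / 12] rounds pass before [y] reaches [1/2]. *)

Require Import Defs.
From mathcomp Require Import all_boot all_order all_algebra.
From mathcomp Require Import all_classical all_reals all_analysis.
From mathcomp Require Import zify ring lra.
Import Order.TTheory GRing.Theory Num.Theory.
Local Open Scope ring_scope.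

Set Implicit Arguments.
Unset Strict Implicit.
Unset Printing Implicit Defensive.

(** * Strategies as positional games *)

Section Game.
Local Open Scope nat_scope.
Variables (T : finType) (e : rel T) (k : nat).
Implicit Types (c : {ffun 'I_k -> T}) (r : T) (s : cop_strategy T k).

Definition cops_step c c' := forall j, step e (c j) (c' j).

(* [c] and [r] are the positions just after a cop move, the robber being next
   to play; [t] counts the remaining cop moves. *)
Fixpoint forced (t : nat) c r : Prop :=
  (exists j, c j = r) \/
  (if t is t'.+1 then
     forall r', step e r r' -> exists2 c', cops_step c c' & forced t' c' r'
   else False).

Lemma forced_cops_win_within t c0 :
  (forall r, exists2 c, cops_step c0 c & forced t c r) ->
  cops_win_within e k t.+1.
Proof.
move=> H.
(* [N] plays a winning reply when there is one and stands still otherwise, so the strategy is legal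
   on every history. *)
have /choice[N HN] : forall x : nat * {ffun 'I_k -> T} * T, exists c',
    cops_step x.1.2 c' /\
    ((exists2 c, cops_step x.1.2 c & forced x.1.1 c x.2) ->
     forced x.1.1 c' x.2).
  move=> [[m c] r] /=.
  have [[c' cc' fc']|nex] := pselect (exists2 c', cops_step c c' & forced m c' r).
    by exists c'; split.
  by exists c; split=> [j|/nex//]; rewrite /step /= eqxx.
(* The history is read from its end; [t - size q] counts the cop moves left after the current
   one. *)
pose fix aux p := if p is v :: q then N (t - size q, aux q, v) else c0.
pose s : cop_strategy T k := fun p => aux (rev p).
have sS (r : nat -> T) i : cops_at s r i.+1 = N (t - i, cops_at s r i, r i).
  by rewrite /cops_at /s mkseqS rev_rcons /= size_rev size_mkseq.
exists s; split=> [r _ i j|r rw].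
  by rewrite sS; case: (HN (t - i, cops_at s r i, r i)).
have N_forced m c v c' :
    cops_step c c' -> forced m c' v -> forced m (N (m, c, v)) v.
  by move=> cc' fc'; apply: (HN (m, c, v)).2; exists c'.
have : forall i, i <= t ->
    (exists2 m, m <= i & captured_in s r m) \/
    forced (t - i) (cops_at s r i.+1) (r i).
  elim=> [_|i IHi lit].
    by right; rewrite sS subn0; have [c cc fc] := H (r 0); apply: N_forced fc.
  have [[m mi cm]|] := IHi (ltnW lit); first by left; exists m => //; lia.
  have -> : t - i = (t - i.+1).+1 by lia.
  move=> /= [[j cj]|fi].
    by left; exists i.+1 => //; exists j; left.
  by right; rewrite sS; have [c cc fc] := fi _ (rw i); apply: N_forced fc.
move=> /(_ t (leqnn t))[[m mt cm]|]; first by exists m => //; apply: leqW.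
rewrite subnn => -[[j cj]|//].
by exists t.+1 => //; exists j; left.
Qed.

(* [Inv i c r] is an invariant that the robber can maintain at the end of every
   round [i]. *)
Lemma evading_walk s (Inv : nat -> {ffun 'I_k -> T} -> T -> Prop) :
  legal e s ->
  (forall c, exists r, Inv 0 c r) ->
  (forall i c c' r, Inv i c r -> cops_step c c' ->
     exists2 r', step e r r' & Inv i.+1 c' r') ->
  exists2 r, robber_walk e r & forall i, Inv i (cops_at s r i) (r i).
Proof.
move=> sl I0 IS; have [x0 _] := I0 (s [::]).
pose ok p v := (p != [::]) ==> step e (last x0 p) v.
(* [g] extends a history legally, and keeps [Inv] whenever that is possible. *)
have /choice[g Hg] : forall p, exists v, ok p v /\
    ((exists2 v', ok p v' & Inv (size p) (s p) v') -> Inv (size p) (s p) v).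
  move=> p.
  have [[v vok Iv]|nex] := pselect (exists2 v', ok p v' & Inv (size p) (s p) v').
    by exists v; split.
  exists (last x0 p); split=> [|/nex//].
  by apply/implyP => _; rewrite /step /= eqxx.
pose S n := iter n (fun p => rcons p (g p)) [::].
pose r n := g (S n).
have Sr n : S n = mkseq r n by elim: n => // n IHn; rewrite mkseqS -IHn.
have lastS n : last x0 (S n.+1) = r n by rewrite Sr mkseqS last_rcons.
have okS n v : ok (S n.+1) v = step e (r n) v.
  by rewrite /ok lastS Sr; case: mkseq (size_mkseq r n.+1).
have rw : robber_walk e r by move=> i; rewrite -okS; case: (Hg (S i.+1)).
have sizeS n : size (S n) = n by rewrite Sr size_mkseq.
exists r => //; elim=> [|i IHi].
  by apply: (Hg [::]).2; have [v Iv] := I0 (s [::]); exists v.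
have := (Hg (S i.+1)).2; rewrite sizeS /cops_at -Sr; apply.
have [r' rr' Ir'] := IS _ _ (cops_at s r i.+1) _ IHi (sl r rw i).
by exists r'; rewrite ?okS // Sr.
Qed.

End Game.

(** * The cube as a game on difference sets *)

Section Hypercube.
Local Open Scope nat_scope.
Variable n : nat.
Implicit Types (x y : n.-tuple bool) (A : {set 'I_n}) (a : option 'I_n).

Definition diffset x y : {set 'I_n} := [set i | tnth x i != tnth y i].

(* A move is a coordinate to flip, or [None] for a pass. *)
Definition flip x a : n.-tuple bool := [tuple tnth x i (+) (a == Some i) | i < n].

Definition toggle A a : {set 'I_n} := [set i | (i \in A) (+) (a == Some i)].

Lemma toggleN A : toggle A None = A.
Proof. by apply/setP => i; rewrite inE addbF. Qed.

Lemma toggle_in {A i} : i \in A -> toggle A (Some i) = A :\ i.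
Proof.
move=> iA; apply/setP => j; rewrite !inE (inj_eq Some_inj) eq_sym.
by case: eqP => [->|]; rewrite ?iA ?addbF.
Qed.

Lemma toggle_notin {A i} : i \notin A -> toggle A (Some i) = i |: A.
Proof.
move=> iA; apply/setP => j; rewrite !inE (inj_eq Some_inj) eq_sym.
by case: eqP => [->|]; rewrite ?(negbTE iA) ?addbF.
Qed.

Lemma toggleC A a b : toggle (toggle A a) b = toggle (toggle A b) a.
Proof. by apply/setP => i; rewrite !inE addbAC. Qed.

Lemma toggleK A a : toggle (toggle A a) a = A.
Proof. by apply/setP => i; rewrite !inE addbK. Qed.

Lemma diff_eq0 x y : diffset x y = finset.set0 -> x = y.
Proof.
move=> /setP d0; apply: eq_from_tnth => i.
by have := d0 i; rewrite !inE => /negbFE/eqP.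
Qed.

Lemma diffC x y : diffset x y = diffset y x.
Proof. by apply/setP => i; rewrite !inE eq_sym. Qed.

Lemma diff_flip x y a : diffset x (flip y a) = toggle (diffset x y) a.
Proof.
apply/setP => i; rewrite !inE tnth_mktuple.
by case: (tnth x i) (tnth y i) (a == Some i) => [] [] [].
Qed.

Lemma diff_flipl x y a : diffset (flip x a) y = toggle (diffset x y) a.
Proof. by rewrite diffC diff_flip diffC. Qed.

Lemma step_flip x a : step (hypercube n) x (flip x a).
Proof.
rewrite /step /=; case: a => [i|]; apply/orP; [right|left].
  apply/cards1P; exists i; apply/setP => j.
  rewrite !inE tnth_mktuple (inj_eq Some_inj) [j == i]eq_sym.
  by case: (tnth x j) (i == j) => [] [].
by apply/eqP/eq_from_tnth => j; rewrite tnth_mktuple addbF.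
Qed.

Lemma step_hypercube x y : step (hypercube n) x y -> exists a, y = flip x a.
Proof.
case/orP => [/eqP <-|/cards1P[i /setP d]]; [exists None|exists (Some i)];
  apply: eq_from_tnth => j; rewrite tnth_mktuple ?addbF //.
have := d j; rewrite !inE (inj_eq Some_inj) (eq_sym i j).
by case: (tnth x j) (tnth y j) (j == i) => [] [] [].
Qed.

Lemma dist_step x x' y : step (hypercube n) x x' ->
  #|diffset x y| <= #|diffset x' y|.+1.
Proof.
move=> /step_hypercube[a ->]; rewrite diff_flipl.
case: a => [i|]; last by rewrite toggleN; lia.
have [iD|iD] := boolP (i \in diffset x y).
  by rewrite toggle_in // (cardsD1 i) iD.
by rewrite toggle_notin // cardsU1 iD; lia.
Qed.

(* The difference sets [D j] of all cops determine the game up to the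
   automorphisms of the cube; [forced_diff] is [forced] read on them. *)
Fixpoint forced_diff (k : nat) (t : nat) (D : 'I_k -> {set 'I_n}) : Prop :=
  (exists j, D j = finset.set0) \/
  (if t is t'.+1 then
     forall a, exists f : 'I_k -> option 'I_n,
       forced_diff t' (fun j => toggle (toggle (D j) a) (f j))
   else False).

Lemma forced_diffP (k t : nat) (c : {ffun 'I_k -> n.-tuple bool}) r :
  forced_diff t (fun j => diffset (c j) r) -> forced (hypercube n) t c r.
Proof.
elim: t c r => [|t IHt] c r /= [[j /diff_eq0 cj]|]; try by left; exists j.
  by [].
move=> H; right=> r' /step_hypercube[a ->].
have [f Hf] := H a; exists [ffun j => flip (c j) (f j)].
  by move=> j; rewrite ffunE; apply: step_flip.
apply: IHt; congr forced_diff: Hf; apply/funext => j.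
by rewrite ffunE diff_flipl diff_flip.
Qed.

Lemma forced_diff0 k t (D : 'I_k -> {set 'I_n}) j :
  D j = finset.set0 -> forced_diff t D.
Proof. by case: t => [|t] Dj; left; exists j. Qed.

Lemma forced_diff_leq k t t' (D : 'I_k -> {set 'I_n}) :
  t <= t' -> forced_diff t D -> forced_diff t' D.
Proof.
elim: t t' D => [|t IHt] [|t'] D //=; first by move=> _ [|//]; left.
move=> tt' [|H]; first by left.
by right=> a; have [f /(IHt _ _ tt')] := H a; exists f.
Qed.

End Hypercube.

(** * Pursuit *)

Section Pursuit.
Local Open Scope nat_scope.
Variables n k : nat.
Implicit Types (D : 'I_k -> {set 'I_n}) (l : 'I_k -> option 'I_n).

Definition total_dist D := \sum_j #|D j|.
Definition coverage D x := #|[set j | x \in D j]|.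
(** Flooring at [tau] lets the coordinate just flipped regain cover up to [tau] at no cost. *)
Definition excess tau D := \sum_x maxn tau (coverage D x).
(** Evenness guarantees a second coordinate to drop once the robber has flipped one in [D j], and
    keeps free cops at distance at least 2. *)
Definition ready D := forall j, D j <> finset.set0 /\ ~~ odd #|D j|.
Definition toggles D l j := toggle (D j) (l j).
Definition movers l : {set 'I_k} := [set j | l j != None].

Lemma sum_coverage D : \sum_x coverage D x = total_dist D.
Proof.
rewrite /total_dist (eq_bigr (fun x => \sum_j (x \in D j : nat))) => [|x _].
  rewrite exchange_big; apply: eq_bigr => j _.
  by rewrite -sum1_card [RHS]big_mkcond; apply: eq_bigr => x _; case: (x \in _).
rewrite /coverage -sum1_card big_mkcond; apply: eq_bigr => j _.
by rewrite inE; case: (x \in _).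
Qed.

Lemma coverage_le D D' x :
  (forall j, x \in D' j -> x \in D j) -> coverage D' x <= coverage D x.
Proof.
by move=> H; apply/subset_leq_card/fintype.subsetP => j; rewrite !inE; apply: H.
Qed.

Lemma remove_redundant D D' j x tau : x \in D j -> tau < coverage D x ->
  (forall j', D' j' = if j' == j then D j :\ x else D j') ->
  total_dist D' + 1 = total_dist D /\ excess tau D' + 1 <= excess tau D.
Proof.
move=> xj tx D'E; split.
  rewrite /total_dist (bigD1 j) //= [in RHS](bigD1 j) //= D'E eqxx.
  rewrite (cardsD1 x (D j)) xj; under eq_bigr => j' jj' do
    rewrite D'E (negbTE jj').
  by rewrite addnC addnA.
have cx : coverage D x = (coverage D' x).+1.
  rewrite /coverage (cardsD1 j) inE xj; congr S; apply: eq_card => j'.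
  by rewrite !inE D'E; case: (j' == j); rewrite ?inE ?eqxx.
rewrite /excess (bigD1 x) //= [in leqRHS](bigD1 x) //= cx; rewrite cx in tx.
rewrite addnAC; apply: leq_add; first by lia.
apply: leq_sum => y _; suff : coverage D' y <= coverage D y by lia.
apply: coverage_le => j'; rewrite D'E.
by case: eqP => // ->; rewrite !inE => /andP[].
Qed.

(* Each cop [j] with [l j != None] gives up a coordinate that is covered more
   than [tau] times, which is why [excess] loses the full amount [s]. *)
Lemma select_redundant D tau s : s <= tau -> n.+1 * tau <= total_dist D ->
  exists l, [/\ #|movers l| = s, total_dist (toggles D l) + s = total_dist D &
    excess tau (toggles D l) + s <= excess tau D].
Proof.
elim: s => [_ _|s IHs st tD].
  exists (fun=> None); have -> : toggles D (fun=> None) = D.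
    by apply/funext => j; rewrite /toggles toggleN.
  split=> //; rewrite ?addn0 //.
  by apply/eqP; rewrite cards_eq0; apply/eqP/setP => j; rewrite !inE.
have [l [ls tl el]] := IHs (ltnW st) tD.
set D' := toggles D l in tl el.
(* Pigeonhole: after [s < tau] removals the total still exceeds [n * tau]. *)
have [x tx] : exists x, tau < coverage D' x.
  apply: contrapT => H.
  have : \sum_x coverage D' x <= \sum_(x < n) tau.
    by apply: leq_sum => x _; rewrite leqNgt; apply/negP => tx; apply: H; exists x.
  by rewrite sum_coverage sum_nat_const card_ord; lia.
have [j xj jl] : exists2 j, x \in D' j & l j = None.
  apply: contrapT => H; suff : coverage D' x <= #|movers l| by lia.
  apply/subset_leq_card/fintype.subsetP => j; rewrite inE => xj; rewrite inE.
  by apply/eqP => jl; apply: H; exists j.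
have D'j : D' j = D j by rewrite /D' /toggles jl toggleN.
pose l' j' := if j' == j then Some x else l j'.
have l'D' j' : toggles D l' j' = if j' == j then D' j :\ x else D' j'.
  by rewrite /toggles /l'; case: eqP => [->|//]; rewrite D'j toggle_in // -D'j.
exists l'; split.
- have -> : movers l' = j |: movers l.
    by apply/setP => j'; rewrite !inE /l'; case: (j' == j).
  by rewrite cardsU1 inE jl ls.
- by have [] := remove_redundant xj tx l'D'; lia.
- by have [] := remove_redundant xj tx l'D'; lia.
Qed.

(* The position reached when the robber, at [D], moves along [i]: the movers
   of [l] play [l], and every other cop whose difference set contains [i] drops
   [i] and a second coordinate. *)
Definition respond D l i j : {set 'I_n} :=
  if l j is Some x then toggle (toggle (D j) (l j)) (Some i)
  else if i \in D j then toggle (D j :\ i) [pick y in D j :\ i] else D j.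

Lemma odd_toggle (A : {set 'I_n}) x : odd #|toggle A (Some x)| = ~~ odd #|A|.
Proof.
have [xA|xA] := boolP (x \in A).
  by rewrite toggle_in // (cardsD1 x A) xA /= negbK.
by rewrite toggle_notin // cardsU1 xA.
Qed.

(** On an empty set [pick] is a pass, so inclusion is unconditional while the parity change needs
    [A] nonempty. *)
Lemma toggle_pick (A : {set 'I_n}) :
  toggle A [pick y in A] \subset A /\
  (A <> finset.set0 -> odd #|toggle A [pick y in A]| = ~~ odd #|A|).
Proof.
case: pickP => [y yA|A0]; rewrite ?toggleN ?odd_toggle.
  by split=> //; rewrite toggle_in // subsetDl.
by split=> // nA; case: nA; apply/setP => y; rewrite A0 inE.
Qed.

Lemma ready_respond D l i : ready D ->
  (forall j, respond D l i j <> finset.set0) -> ready (respond D l i).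
Proof.
move=> rD r0 j; split; first exact: r0.
rewrite /respond; have [D0 oD] := rD j; case: (l j) => [x|].
  by rewrite !odd_toggle !negbK.
have [iD|//] := boolP (i \in D j).
have oi : odd #|D j :\ i|.
  by move: oD; rewrite (cardsD1 i (D j)) iD /= negbK.
rewrite (toggle_pick _).2 ?oi // => E.
by rewrite E cards0 in oi.
Qed.

(** Only movers can hold [i] afterwards, so its coverage is absorbed by the floor [#|movers l|]; no
    other coordinate gains cover. *)
Lemma excess_respond D l i :
  excess #|movers l| (respond D l i) <= excess #|movers l| (toggles D l).
Proof.
apply: leq_sum => x _.
have [->|xi] := eqVneq x i.
  suff : coverage (respond D l i) i <= #|movers l| by lia.
  apply/subset_leq_card/fintype.subsetP => j; rewrite !inE /respond.
  case: (l j) => // ; have [iD|/negbTE-> //] := boolP (i \in D j).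
  by move=> /(fintype.subsetP (toggle_pick _).1); rewrite !inE eqxx.
suff : coverage (respond D l i) x <= coverage (toggles D l) x by lia.
apply: coverage_le => j; rewrite /respond /toggles; case: (l j) => [y|].
  by rewrite !inE !(inj_eq Some_inj) [i == x]eq_sym (negbTE xi) addbF.
rewrite toggleN; case: ifP => // _.
by move=> /(fintype.subsetP (toggle_pick _).1); rewrite !inE => /andP[].
Qed.

(* Second reply to a robber who passes twice. *)
Definition press D l j : {set 'I_n} :=
  if l j is Some x then toggle (toggles D l j) [pick y in toggles D l j]
  else D j.

Lemma ready_press D l : ready D ->
  (forall j, toggles D l j <> finset.set0) ->
  (forall j, press D l j <> finset.set0) -> ready (press D l).
Proof.
move=> rD t0 p0 j; split; first exact: p0.
rewrite /press; have [D0 oD] := rD j; have := t0 j; rewrite /toggles.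
case: (l j) => [x|//] tj.
by rewrite (toggle_pick _).2 // odd_toggle !negbK.
Qed.

Lemma excess_press D l tau : excess tau (press D l) <= excess tau (toggles D l).
Proof.
apply: leq_sum => x _.
suff : coverage (press D l) x <= coverage (toggles D l) x by lia.
apply: coverage_le => j; rewrite /press /toggles; case: (l j) => [y|].
  exact: (fintype.subsetP (toggle_pick _).1).
by rewrite toggleN.
Qed.

Lemma forced_respond D l t i : ready D ->
  (forall D', ready D' ->
     excess #|movers l| D' <= excess #|movers l| (toggles D l) ->
     forced_diff t D') ->
  forced_diff t (respond D l i).
Proof.
move=> rD H; have [[j]|n0] := pselect (exists j, respond D l i j = finset.set0).
  exact: forced_diff0.
apply: H; last exact: excess_respond.
by apply: ready_respond => // j rj; apply: n0; exists j.
Qed.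

Lemma forced_macro D tau t : ready D -> n.+1 * tau <= total_dist D ->
  (forall D', ready D' -> excess tau D' + tau <= excess tau D ->
     forced_diff t D') ->
  forced_diff t.+2 D.
Proof.
move=> rD tD H; have [l [lt _ el]] := select_redundant (leqnn tau) tD.
have H' D' : ready D' ->
    excess #|movers l| D' <= excess #|movers l| (toggles D l) -> forced_diff t D'.
  by move=> rD' eD'; apply: H => //; rewrite lt in eD'; lia.
right=> -[i|].
  (* Immediate flip: sacrifices and answers fit in one cop move. *)
  exists (fun j => if l j is Some x then l j else if i \in D j
                   then [pick y in D j :\ i] else Some i).
  apply: (@forced_diff_leq _ _ t) => //.
  set D' := (X in forced_diff t X).
  suff -> : D' = respond D l i by apply: forced_respond.
  apply/funext => j; rewrite /D' /respond.
  case: (l j) => [x|]; first by rewrite toggleC.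
  have [iD|iD] := boolP (i \in D j); first by rewrite toggle_in.
  by rewrite toggleK.
(* First pass: the sacrifices are made now and leave the movers at odd distance; a later flip
   restores their parity while they stand still. *)
exists l; set D' := (X in forced_diff t.+1 X).
have {D'}-> : D' = toggles D l by apply/funext => j; rewrite /D' toggleN.
have [[j]|n0] := pselect (exists j, toggles D l j = finset.set0).
  exact: forced_diff0.
right=> -[i|].
  exists (fun j => if l j is Some x then None else if i \in D j
                   then [pick y in D j :\ i] else Some i).
  set D' := (X in forced_diff t X).
  suff -> : D' = respond D l i by apply: forced_respond.
  apply/funext => j; rewrite /D' /respond /toggles.
  case: (l j) => [x|]; first by rewrite toggleN.
  rewrite toggleN; have [iD|iD] := boolP (i \in D j); first by rewrite toggle_in.
  by rewrite toggleK.
(* Second pass: each mover restores its parity by dropping one more coordinate. *)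
exists (fun j => if l j is Some x then [pick y in toggles D l j] else None).
set D' := (X in forced_diff t X).
have {D'}-> : D' = press D l.
  apply/funext => j; rewrite /D' /press /toggles.
  by case: (l j) => [x|]; rewrite !toggleN.
have [[j]|n1] := pselect (exists j, press D l j = finset.set0).
  exact: forced_diff0.
apply: H'; last exact: excess_press.
by apply: ready_press => // j E; [apply: n0|apply: n1]; exists j.
Qed.

(** Every two cop moves cost the excess [tau], so within [q] such pairs the total falls below the
    threshold or the robber is caught. *)
Lemma forced_phase tau t : 0 < tau ->
  (forall D, ready D -> total_dist D < n.+1 * tau -> forced_diff t D) ->
  forall q D, ready D -> excess tau D < q * tau -> forced_diff (q.*2 + t) D.
Proof.
move=> tau0 H; elim=> [|q IHq] D rD eD; first by rewrite ltn0 in eD.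
have [tD|tD] := leqP (n.+1 * tau) (total_dist D).
  rewrite doubleS !addSn; apply: forced_macro tD _ => // D' rD' eD'.
  by apply: IHq => //; lia.
by apply: forced_diff_leq (H D rD tD); apply: leq_addl.
Qed.

Lemma excess_le tau D : excess tau D <= n * tau + total_dist D.
Proof.
rewrite -sum_coverage; have <- : \sum_(x < n) tau = n * tau.
  by rewrite sum_nat_const card_ord.
by rewrite -big_split /=; apply: leq_sum => x _; lia.
Qed.

Lemma ready_total_dist D : ready D -> k.*2 <= total_dist D.
Proof.
move=> rD; have -> : k.*2 = \sum_(j < k) 2.
  by rewrite sum_nat_const card_ord muln2.
apply: leq_sum => j _; have [D0] := rD j.
have : #|D j| != 0 by rewrite cards_eq0; apply/eqP.
by case: #|D j| => [|[|]].
Qed.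

(** Each phase, with [tau = 2 ^ p], halves the bound on the total; its initial excess is below
    [3 * n.+1 * tau]. At [p = 0] the total would be below [k.*2], impossible for a ready
    position. *)
Lemma forced_ready p D : n < k.*2 -> ready D -> total_dist D < n.+1 * 2 ^ p ->
  forced_diff ((3 * n.+1).*2 * p) D.
Proof.
move=> nk; elim: p D => [|p IHp] D rD tD.
  by have := ready_total_dist rD; lia.
rewrite mulnS; apply: (@forced_phase (2 ^ p)) => //; first by rewrite expn_gt0.
have := excess_le (2 ^ p) D; rewrite expnS in tD.
by nia.
Qed.

Lemma cops_win_within_hypercube p : n < k.*2 -> k <= 2 ^ p ->
  cops_win_within (hypercube n) k ((3 * n.+1).*2 * p).+1.
Proof.
move=> nk kp; pose x0 : n.-tuple bool := [tuple false | i < n].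
apply: (@forced_cops_win_within _ _ _ _ [ffun=> x0]) => r.
(* All cops start together; their first move makes the common distance even and accounts for the
   extra round. *)
pose a := if odd #|diffset x0 r| then [pick y in diffset x0 r] else None.
exists [ffun=> flip x0 a].
  by move=> j; rewrite !ffunE; apply: step_flip.
apply: forced_diffP; set D := (X in forced_diff _ X).
have DE j : D j = toggle (diffset x0 r) a by rewrite /D ffunE diff_flipl.
have [[j]|n0] := pselect (exists j, D j = finset.set0).
  exact: forced_diff0.
apply: forced_ready => // [j|].
  split; first by move=> Dj; apply: n0; exists j.
  rewrite DE /a; case: (boolP (odd #|diffset x0 r|)) => [oD|];
    last by rewrite toggleN.
  rewrite (toggle_pick _).2 ?oD // => E.
  by rewrite E cards0 in oD.
apply: (@leq_ltn_trans (\sum_(j < k) n)).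
  by apply: leq_sum => j _; rewrite -[leqRHS]card_ord max_card.
rewrite sum_nat_const card_ord; have : 0 < 2 ^ p by rewrite expn_gt0.
by nia.
Qed.

End Pursuit.

(** * Evasion *)

Section Evasion.
Variables (R : realType) (n k : nat).
Implicit Types (x u : R) (c : {ffun 'I_k -> n.-tuple bool}) (r : n.-tuple bool).

(** A cop landing on the robber by its own move was within distance 1 at the end of the previous
    round. *)
Lemma not_captured (s : cop_strategy (n.-tuple bool) k) w t :
  legal (hypercube n) s -> robber_walk (hypercube n) w ->
  (forall m, (m <= t)%N -> forall j, (1 < #|diffset (cops_at s w m j) (w m)|)%N) ->
  forall i, (i <= t)%N -> ~ captured_in s w i.
Proof.
move=> sl ww far i it [j].
have far_neq m : (m <= t)%N -> cops_at s w m j <> w m.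
  move=> mt E; have := far m mt j; rewrite E.
  by have -> : diffset (w m) (w m) = finset.set0;
    [apply/setP => y; rewrite !inE eqxx|rewrite cards0].
case: i it => [|i] it /= [E|E]; try exact: (far_neq _ it E).
have /dist_step : step (hypercube n) (cops_at s w i j) (cops_at s w i.+1 j).
  exact: sl.
move=> /(_ (w i)); rewrite E; have := far i (ltnW it) j.
have -> : diffset (w i) (w i) = finset.set0.
  by apply/setP => y; rewrite !inE eqxx.
by rewrite cards0; lia.
Qed.

Definition weight x c r : R := \sum_j x ^+ #|diffset (c j) r|.

(** A cop within distance 1 would alone contribute at least [x]. *)
Lemma weight_far x c r : 1/2 <= x -> x <= 1 -> weight x c r < 1/2 ->
  forall j, (1 < #|diffset (c j) r|)%N.
Proof.
move=> x12 x1 W j; rewrite ltnNge; apply/negP => d1.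
have : x ^+ #|diffset (c j) r| <= weight x c r.
  rewrite /weight (bigD1 j) //= lerDl; apply: sumr_ge0 => i _.
  by apply: exprn_ge0; lra.
by case: #|_| d1 => [|[|//]] _; rewrite ?expr0 ?expr1; lra.
Qed.

(** Expand a product over coordinates in which agreement contributes 1 and difference contributes
    [x]. *)
Lemma sum_weight1 x (v : n.-tuple bool) :
  \sum_(r : n.-tuple bool) x ^+ #|diffset v r| = (1 + x) ^+ n.
Proof.
pose F i (b : bool) : R := if tnth v i != b then x else 1.
have -> : (1 + x) ^+ n = \prod_(i < n) \sum_b F i b.
  rewrite (eq_bigr (fun=> 1 + x)) ?prodr_const ?card_ord // => i _.
  by rewrite big_bool /F; case: (tnth v i); rewrite //= addrC.
rewrite bigA_distr_bigA /=.
rewrite (reindex (fun f : {ffun 'I_n -> bool} => [tuple f i | i < n])) /=.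
  apply: eq_bigr => f _; rewrite -big_mkcond /= prodr_const; congr (_ ^+ _).
  by apply: eq_card => i; rewrite !inE tnth_mktuple.
exists (fun r : n.-tuple bool => [ffun i => tnth r i]) => [f|r] _.
  by apply/ffunP => i; rewrite ffunE tnth_mktuple.
by apply: eq_from_tnth => i; rewrite tnth_mktuple ffunE.
Qed.

(** First moment over a uniformly random starting vertex. *)
Lemma weight_start x c : k%:R * ((1 + x) / 2) ^+ n < 1/2 ->
  exists r, weight x c r < 1/2.
Proof.
move=> H; apply: contrapT => nex.
have : \sum_(r : n.-tuple bool) (1/2 : R) <= \sum_(r : n.-tuple bool) weight x c r.
  apply: ler_sum => r _; rewrite leNgt; apply/negP => W; apply: nex.
  by exists r.
rewrite /weight exchange_big; under [leRHS]eq_bigr => j _ do rewrite sum_weight1.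
rewrite !sumr_const card_ord card_tuple card_bool.
rewrite -[leLHS]mulr_natl -[leRHS]mulr_natl natrX.
move: H; rewrite expr_div_n mulrA ltr_pdivrMr ?exprn_gt0 //.
by lra.
Qed.

Lemma sum_toggle x (A : {set 'I_n}) :
  \sum_i x ^+ #|toggle A (Some i)| =
  #|A|%:R * x ^+ #|A|.-1 + (n%:R - #|A|%:R) * x ^+ #|A|.+1.
Proof.
rewrite (bigID (fun i => i \in A)) /=; congr (_ + _).
  rewrite (eq_bigr (fun=> x ^+ #|A|.-1)) ?sumr_const ?mulr_natl // => i iA.
  by rewrite toggle_in // (cardsD1 i A) iA.
rewrite (eq_bigr (fun=> x ^+ #|A|.+1)) => [|i iA]; last first.
  by rewrite toggle_notin // cardsU1 iA.
rewrite sumr_const -[LHS]mulr_natl; congr (_ * _).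
have := cardC (mem A); rewrite card_ord => /(congr1 (fun m => m%:R : R)).
rewrite natrD => /= <-.
by rewrite addrAC subrr add0r.
Qed.

Lemma exprD_ge x z m : 0 <= x -> 0 <= z ->
  x ^+ m.+1 + m.+1%:R * x ^+ m * z <= (x + z) ^+ m.+1.
Proof.
move=> x0 z0; elim: m => [|m IHm]; first by rewrite !expr1 expr0; lra.
rewrite [leRHS]exprS; apply: le_trans (ler_wpM2l _ IHm); last by lra.
have xm : 0 <= x ^+ m by exact: exprn_ge0.
rewrite (exprS x m.+1) (exprS x m) -[m.+2%:R]natr1 -[m.+1%:R]natr1.
have m0 : 0 <= m%:R :> R by exact: ler0n.
have : 0 <= x ^+ m * (m%:R + 1) * z * z by rewrite !mulr_ge0 //; lra.
by move=> H; rewrite -subr_ge0; congr (0 <= _): H; ring.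
Qed.

(** With d = [#|A|], the sum exceeds n x^(d+1) by d x^(d-1) (1 - x^2); the hypothesis lets the
    linear term n (d+1) x^d (u - x) of n u^(d+1) pay for this. The exponent d + 1 accounts for the
    cop's step closer. *)
Lemma sum_toggle_le x u (A : {set 'I_n}) : 0 < x -> x <= 1 -> x <= u ->
  1 - x ^+ 2 <= n%:R * x * (u - x) ->
  \sum_i x ^+ #|toggle A (Some i)| <= n%:R * u ^+ #|A|.+1.
Proof.
move=> x0 x1 xu H; rewrite sum_toggle.
case: #|A| => [|m] /=.
  by rewrite mul0r add0r subr0 !expr1; apply: ler_wpM2l.
have := @exprD_ge x (u - x) m.+1 (ltW x0).
rewrite (addrC x (u - x)) subrK => /(_ ltac:(lra)) U.
apply: le_trans (ler_wpM2l (ler0n _ n) U).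
have xm : 0 <= x ^+ m by exact/exprn_ge0/ltW.
have m0 : 0 <= m%:R :> R by exact: ler0n.
have : 0 <= m.+2%:R * x ^+ m * (n%:R * x * (u - x) - (1 - x ^+ 2)).
  by rewrite !mulr_ge0 ?ler0n //; lra.
have : 0 <= x ^+ m * (1 - x ^+ 2).
  by rewrite mulr_ge0 // subr_ge0 expr_le1 // ltW.
rewrite !exprS expr0 mulr1 -[m.+2%:R]natr1 -[m.+1%:R]natr1 => H1 H2.
by rewrite -subr_ge0; apply: le_trans (addr_ge0 H1 H2) _; rewrite le_eqVlt;
  apply/orP; left; apply/eqP; ring.
Qed.

(* The robber flips a uniformly random coordinate; the expected weight does not
   grow even if every cop has just stepped closer. *)
Lemma weight_step x u c c' r : (0 < n)%N -> 0 < x -> x <= 1 -> x <= u -> u <= 1 ->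
  1 - x ^+ 2 <= n%:R * x * (u - x) ->
  cops_step (hypercube n) c c' -> weight u c r < 1/2 ->
  exists i, weight x c' (flip r (Some i)) < 1/2.
Proof.
move=> n0 x0 x1 xu u1 H cc' W; apply: contrapT => nex.
have : \sum_(i < n) (1/2 : R) <= \sum_i weight x c' (flip r (Some i)).
  apply: ler_sum => i _; rewrite leNgt; apply/negP => W'; apply: nex.
  by exists i.
rewrite /weight exchange_big /= sumr_const card_ord -[leLHS]mulr_natl.
apply/negP; rewrite -ltNge.
apply: (@le_lt_trans _ _ (n%:R * weight u c r)); last first.
  by rewrite ltr_pM2l // ltr0n.
rewrite /weight mulr_sumr; apply: ler_sum => j _.
under eq_bigr => i _ do rewrite diff_flip.
apply: le_trans (sum_toggle_le _ x0 x1 xu H) _.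
apply: ler_wpM2l => //; apply: ler_wiXn2l => //; first by lra.
exact: dist_step.
Qed.

Lemma not_cops_win_within t : (3 < n)%N ->
  k%:R * (1 - (1 - 3 / n%:R) ^+ t / 4) ^+ n < 1/2 :> R ->
  ~ cops_win_within (hypercube n) k t.
Proof.
move=> n3 H [s [sl sw]].
have n0 : 0 < n%:R :> R by rewrite ltr0n; lia.
pose q : R := 1 - 3 / n%:R.
have q0 : 0 <= q by rewrite subr_ge0 ler_pdivrMr // mul1r ler_nat ltnW.
have q1 : q <= 1 by rewrite lerBlDr lerDl divr_ge0 // ltW.
have qm m : 0 <= q ^+ m <= 1 by rewrite exprn_ge0 // exprn_ile1.
(* [1 - x i] grows by the factor [1 / q] each round and reaches exactly 1/2 in round [t], so
   [weight_far] applies throughout. *)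
pose x i : R := 1 - q ^+ (t - i) / 2.
have [] := @evading_walk _ (hypercube n) k s
  (fun i c r => (i <= t)%N -> weight (x i) c r < 1/2) sl.
- move=> c; have [|r Wr] := @weight_start (x 0) c; last by exists r.
  congr (_ * _ ^+ _ < _): H; rewrite /x subn0 -/q.
  by have -> : (4 : R) = 2 * 2 by [lra|]; field.
- move=> i c c' r Ir cc'; have [it|ti] := ltnP i t; last first.
    by exists r; [rewrite /step /= eqxx|lia].
  have xE : 1 - x i = (1 - x i.+1) * q.
    by rewrite /x (_ : t - i = (t - i.+1).+1)%N ?exprS; [ring|lia].
  have /andP[Q0 Q1] := qm (t - i.+1)%N.
  have x12 : 1/2 <= x i.+1 by rewrite /x; lra.
  have x1 : x i.+1 <= 1 by rewrite /x; lra.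
  have y0 : 0 <= 1 - x i.+1 by lra.
  have xiE : n%:R * (x i - x i.+1) = 3 * (1 - x i.+1).
    have -> : x i - x i.+1 = (1 - x i.+1) * (1 - q) by rewrite -[x i](subKr 1) xE; ring.
    by rewrite /q; field; rewrite gt_eqF.
  have [||||||v Wv] := @weight_step (x i.+1) (x i) c c' r _ _ x1 _ _ _ cc'.
  + exact: ltn_trans n3.
  + by lra.
  + have : 0 <= (1 - x i.+1) * (1 - q) by rewrite mulr_ge0 // subr_ge0.
    by rewrite mulrBr mulr1 -xE; lra.
  + have : 0 <= (1 - x i.+1) * q by rewrite mulr_ge0.
    by rewrite -xE; lra.
  (* The 3 in [q] turns the condition into 1 - x^2 <= 3 x (1 - x), which holds because x >= 1/2. *)
  + rewrite mulrAC xiE -subr_ge0.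
    have : 0 <= (1 - x i.+1) * (2 * x i.+1 - 1) by rewrite mulr_ge0 //; lra.
    by move=> H'; congr (0 <= _): H'; ring.
  + exact/Ir/ltnW.
  by exists (flip r (Some v)); [exact: step_flip|].
move=> w ww Iw; have [i it] := sw w ww.
apply: (not_captured (t := t)) => // m mt.
have /andP[Q0 Q1] := qm (t - m)%N.
by apply: (@weight_far (x m)) (Iw m mt); rewrite /x; lra.
Qed.

(** If some cop is at distance 1, the difference sets of size at most 2 have total size at most 2k -
    1 < n, so some coordinate lies in none of them; flipping it retreats from every near cop.
    Otherwise a pass is safe. *)
Lemma escape_trap (D : 'I_k -> {set 'I_n}) : (k.*2 <= n)%N ->
  (forall j, (0 < #|D j|)%N) -> exists a, forall j, (1 < #|toggle (D j) a|)%N.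
Proof.
move=> kn D0; have [[j0 Dj0]|no1] := pselect (exists j, #|D j| = 1%N); last first.
  exists None => j; rewrite toggleN ltn_neqAle eq_sym D0 andbT.
  by apply/eqP => Dj; apply: no1; exists j.
pose B j := if (#|D j| <= 2)%N then D j else finset.set0.
have B2 j : (#|B j| <= 2)%N by rewrite /B; case: ifP; rewrite ?cards0.
have : (total_dist B < n)%N.
  have Bj0 : #|B j0| = 1%N by rewrite /B Dj0.
  rewrite /total_dist (bigD1 j0) //= Bj0.
  apply: (@leq_ltn_trans (1 + \sum_(j < k | j != j0) 2)%N).
    by rewrite leq_add2l; apply: leq_sum.
  by rewrite sum_nat_const cardC1 card_ord; have := ltn_ord j0; lia.
rewrite -sum_coverage => Bn.
have [i Bi] : exists i, coverage B i = 0%N.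
  apply: contrapT => nex; move: Bn; apply/negP; rewrite -leqNgt.
  rewrite -[leqLHS]card_ord -sum1_card; apply: leq_sum => i _.
  by rewrite lt0n; apply/eqP => Bi; apply: nex; exists i.
exists (Some i) => j.
have iB : i \notin B j.
  by move/eqP: Bi; rewrite cards_eq0 => /eqP/setP/(_ j); rewrite !inE => ->.
have [iD|iD] := boolP (i \in D j).
  move: iB; rewrite toggle_in // /B.
  case: (leqP #|D j| 2) => [_|D2 _]; first by rewrite iD.
  by move: D2; rewrite (cardsD1 i (D j)) iD.
by rewrite toggle_notin // cardsU1 iD ltnS D0.
Qed.

(** The weight at 1/2 is used only to find a safe start, whence 3/4 = (1 + 1/2) / 2; afterwards
    [escape_trap] suffices. *)
Lemma not_cops_win : (k.*2 <= n)%N -> k%:R * (3 / 4) ^+ n < 1/2 :> R ->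
  ~ cops_win (hypercube n) k.
Proof.
move=> kn H [s [sl sw]].
have [] := @evading_walk _ (hypercube n) k s
  (fun _ c r => forall j, (1 < #|diffset (c j) r|)%N) sl.
- move=> c; have [|r Wr] := @weight_start (1/2) c.
    by congr (_ * _ ^+ _ < _): H; lra.
  by exists r; apply: weight_far Wr; lra.
- move=> _ c c' r far cc'.
  have [j|a Ha] := @escape_trap (fun j => diffset (c' j) r) kn.
    by rewrite -ltnS; apply: leq_trans (far j) (dist_step r (cc' j)).
  by exists (flip r a); [exact: step_flip|move=> j; rewrite diff_flip].
move=> w ww far; have [i] := sw w ww.
by apply: (not_captured (t := i)).
Qed.

End Evasion.

(** * Asymptotics *)

Lemma capture_timeP (T : finType) (e : rel T) (t : nat) :
  reflect (cops_win_within e (cop_number e) t) (capture_time e <= t)%N.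
Proof.
rewrite /capture_time /capture_time_with; case: ex_minnP => m /asboolP mwin mmin.
apply: (iffP idP) => [mt|twin]; last by apply/mmin/asboolP.
have [s [sl sw]] := mwin; exists s; split=> // r /sw[i im ci].
by exists i => //; apply: leq_trans mt.
Qed.

Lemma cop_number_le (T : finType) (e : rel T) (k : nat) :
  cops_win e k -> (cop_number e <= k)%N.
Proof. by rewrite /cop_number; case: ex_minnP => m _ H /asboolP/H. Qed.

Lemma cops_win_withinW (T : finType) (e : rel T) (k t : nat) :
  cops_win_within e k t -> cops_win e k.
Proof. by move=> [s [sl sw]]; exists s; split=> // r /sw[i _]; exists i. Qed.

Section Asymptotics.
Variables (R : realType) (n : nat).
Hypothesis n_ge : (2 ^ 18 <= n)%N.
Implicit Types k t : nat.

Let n_geR : 1024 * 256 <= n%:R :> R.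
Proof.
have : (2 ^ 18)%:R <= n%:R :> R by rewrite ler_nat.
by apply: le_trans; rewrite natrX !exprS expr0; lra.
Qed.

Let n_gt0 : 0 < n%:R :> R. Proof. by have := n_geR; lra. Qed.

Lemma small_weight k t : (k <= n)%N -> t%:R <= n%:R * ln (n%:R : R) / 12 ->
  k%:R * (1 - (1 - 3 / n%:R) ^+ t / 4) ^+ n < 1/2 :> R.
Proof.
move=> kn tn; set q : R := 1 - 3 / n%:R.
(* [S] is the square root of [n]. *)
pose S : R := expR (ln n%:R / 2).
have S0 : 0 < S by exact: expR_gt0.
have S2 : S ^+ 2 = n%:R.
  by rewrite /S -expRM_natr -mulrA mulVf ?pnatr_eq0 // mulr1 lnK // posrE.
have n3 : 0 <= (3 / n%:R : R) <= 1/2.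
  by rewrite divr_ge0 ?ler_pdivrMr ?(ltW n_gt0) //=; have := n_geR; lra.
(* 1 - v >= exp(-2v) for 0 <= v <= 1/2, at v = 3/n. Hence q^t >= exp(-6t/n) >= 1/S when t <= n ln n
   / 12. *)
have q_ge : expR (- (6 / n%:R)) <= q.
  rewrite expRN invf_ple ?posrE ?expR_gt0 //; last by rewrite /q; lra.
  apply: le_trans (expR_ge1Dx _).
  rewrite -[leLHS]mul1r ler_pdivrMr /q; last by lra.
  by rewrite (_ : 6 / n%:R = 2 * (3 / n%:R)); [nra|ring].
have qt : S^-1 <= q ^+ t.
  apply: le_trans (lerXn2r t _ _ q_ge); rewrite ?nnegrE ?expR_ge0 //;
    last by rewrite /q; lra.
  rewrite /S -expRN -expRM_natr ler_expR mulNr lerN2.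
  rewrite mulrAC ler_pdivrMr //; lra.
have q01 : 0 <= q ^+ t <= 1.
  by rewrite exprn_ge0 ?exprn_ile1 // /q; lra.
have base : (1 - q ^+ t / 4) ^+ n <= expR (- (S / 4)).
  have -> : - (S / 4) = - (S^-1 / 4) * n%:R.
    by rewrite -S2; field; rewrite gt_eqF.
  rewrite expRM_natr; apply: lerXn2r; rewrite ?nnegrE ?expR_ge0 //; first by lra.
  by apply: le_trans (expR_ge1Dx _); lra.
(* It remains to beat n = 256 s^2 by exp(4s) >= s^4 with a factor 2 to spare; s^2 >= 1024 is the
   source of the threshold 2^18. *)
pose s : R := S / 16.
have s0 : 0 < s by rewrite divr_gt0.
have nE : n%:R = 256 * s ^+ 2 by rewrite -S2 /s; field.
have s_ge : 1024 <= s ^+ 2 by have := n_geR; rewrite nE; lra.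
have es : s ^+ 4 <= expR (S / 4).
  have -> : S / 4 = s * 4%:R by rewrite /s; field.
  rewrite expRM_natr; apply: lerXn2r; rewrite ?nnegrE ?expR_ge0 ?(ltW s0) //.
  by apply: le_trans (expR_ge1Dx _); lra.
apply: (@le_lt_trans _ _ (n%:R * expR (- (S / 4)))).
  apply: ler_pM => //; rewrite ?ler_nat //.
  by apply: exprn_ge0; lra.
rewrite expRN ltr_pdivrMr ?expR_gt0 //.
apply: (@lt_le_trans _ _ (1/2 * s ^+ 4)); last by rewrite ler_pM2l //; lra.
by rewrite nE (_ : s ^+ 4 = s ^+ 2 * s ^+ 2); [nra|ring].
Qed.

Let t0 := Num.truncn (n%:R * ln (n%:R : R) / 12).

Let ln_n_gt0 : 0 < ln (n%:R : R).
Proof. by apply: ln_gt0; have := n_geR; lra. Qed.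

Let t0_le : t0%:R <= n%:R * ln (n%:R : R) / 12.
Proof. by rewrite Num.Theory.truncn_le // divr_ge0 // mulr_ge0 // ltW. Qed.

Let p := (trunc_log 2 n).+1.

Let n_lt2p : (n < 2 ^ p)%N.
Proof. by apply: trunc_log_ltn. Qed.

Lemma cop_number_hypercube : cop_number (hypercube n) = n./2.+1.
Proof.
have n4 : (4 < n)%N by apply: leq_trans n_ge.
have kn : (cop_number (hypercube n) <= n./2.+1)%N.
  apply/cop_number_le/(@cops_win_withinW _ _ _ ((3 * n.+1).*2 * p).+1).
  by apply: cops_win_within_hypercube; [lia|apply: leq_trans (ltnW n_lt2p); lia].
apply/eqP; rewrite eqn_leq kn leqNgt; apply/negP => kn'.
apply: (@not_cops_win R n (cop_number (hypercube n))).
- by lia.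
(* At [t = 0] the base of the power is exactly 3/4. *)
- have := @small_weight (cop_number (hypercube n)) 0.
  rewrite expr0 (_ : 1 - 1 / 4 = 3 / 4 :> R); last by lra.
  by apply; [lia|rewrite divr_ge0 // mulr_ge0 // ltW].
exact: cop_number_win.
Qed.

Lemma capture_time_hypercube_ge :
  1 / 12 * n%:R * ln (n%:R : R) <= (capture_time (hypercube n))%:R.
Proof.
have : (t0 < capture_time (hypercube n))%N.
  rewrite ltnNge; apply/capture_timeP; rewrite cop_number_hypercube.
  apply: (@not_cops_win_within R); first by apply: leq_trans n_ge.
  by apply: small_weight t0_le; have := n_ge; lia.
rewrite -(ler_nat R) => /(le_trans _); apply.
have /ltW x_ge0 := divr_gt0 (mulr_gt0 n_gt0 ln_n_gt0) (ltr0n R 12).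
have /andP[_ /ltW] := truncn_itv x_ge0.
by rewrite -/t0; lra.
Qed.

Lemma capture_time_hypercube_le :
  (capture_time (hypercube n))%:R <= 25 / ln 2 * n%:R * ln (n%:R : R).
Proof.
have : (capture_time (hypercube n) <= ((3 * n.+1).*2 * p).+1)%N.
  apply/capture_timeP; rewrite cop_number_hypercube.
  apply: cops_win_within_hypercube; first by lia.
  by apply: leq_trans (ltnW n_lt2p); have := n_ge; lia.
rewrite -(ler_nat R) => /le_trans; apply.
have ln20 : 0 < ln 2 :> R by apply: ln_gt0; lra.
have [z1 zp] : 1 <= ln n%:R / ln 2 :> R /\ (trunc_log 2 n)%:R <= ln n%:R / ln 2 :> R.
  rewrite !ler_pdivlMr // mul1r; split.
    by rewrite ler_ln ?posrE //; have := n_geR; lra.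
  rewrite mulr_natl -lnXn //; rewrite ler_ln ?posrE ?exprn_gt0 // -natrX ler_nat.
  by apply: trunc_logP => //; apply: leq_trans n_ge.
(* As 1 <= z, the bound is at most 12 (n+1) z + 1 <= 12 n z + 13 z <= 25 n z. *)
set z := ln n%:R / ln 2 in z1 zp.
rewrite (_ : 25 / ln 2 * n%:R * ln n%:R = 25 * n%:R * z); last by rewrite /z; ring.
rewrite -natr1 natrM -muln2 !natrM /p -!natr1.
have := n_geR; nra.
Qed.

End Asymptotics.

Theorem theorem1p1 (R : realType) :
  exists c1 c2 : R, [/\ 0 < c1, 0 < c2 &
    exists n0 : nat, forall n : nat, (n0 <= n)%N ->
      c1 * n%:R * ln (n%:R : R) <= (capture_time (hypercube n))%:R
        <= c2 * n%:R * ln (n%:R : R)].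
Proof.
exists (1 / 12), (25 / ln 2); split; first by lra.
  by rewrite divr_gt0 // ln_gt0 //; lra.
exists (2 ^ 18)%N => n n_ge.
by rewrite capture_time_hypercube_ge // capture_time_hypercube_le.
Qed.
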